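(* Let $(X,T)$ be a dynamical system and let $\mu\in M(X)$. If $(T,\mu)$ satisfies LDT-I', then $\mu$ is ergodic.
   Context: A dynamical system is a pair $(X,T)$ where $X$ is a compact metric space and $T:X\to X$ is a continuous map. $M(X)$ is the set of Borel probability measures on $X$ (not assumed $T$-invariant) and $M(X,T)\subset M(X)$ the set of $T$-invariant ones. An observable is a continuous complex-valued function $\varphi\in C(X)$. The pair $(T,\mu)$ satisfies the large deviations theorem of type I' (LDT-I') if, for every observable $\varphi$ and any $\varepsilon>0$, $$\sum_{n=1}^{+\infty}\mu\left(\left\{x\in X:\left|\frac{1}{n}\sum_{i=0}^{n-1}\varphi\circ T^{i}(x)-\int_X\varphi\,\mathrm{d}\mu\right|>\varepsilon\right\}\right)<+\infty.$$ A measure $\mu\in M(X)$ is ergodic if $\mu\in M(X,T)$ and every Borel set $B$ with $T^{-1}(B)=B$ satisfies $\mu(B)\in\{0,1\}$. *)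

(* Defs.v *)
From HB Require Import structures.
From mathcomp Require Import all_boot all_order all_algebra.
From mathcomp Require Import complex.
From mathcomp Require Import all_classical all_reals all_analysis.

Set Implicit Arguments.
Unset Strict Implicit.
Unset Printing Implicit Defensive.

Import Order.TTheory GRing.Theory Num.Theory.
Import numFieldNormedType.Exports.

Local Open Scope classical_set_scope.
Local Open Scope ring_scope.

(* [measurableType] requires a pointed carrier. This costs no generality:
   a space carrying a probability measure is nonempty. *)
#[short(type="pointedMetricType")]
HB.structure Definition PointedMetric (R : numDomainType) :=
  {X of Metric R X & isPointed X}.

Definition borel (R : realType) (X : pointedMetricType R) :=
  g_sigma_algebraType (@open X).

Section Dynamics.
Variables (R : realType) (X : pointedMetricType R).
Implicit Types (T : X -> X) (mu : probability (borel X) R).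

(* The regular module [R[i]^o] carries the topology of the complex modulus. *)
Definition observable (phi : X -> R[i]) : Prop :=
  continuous (phi : X -> R[i]^o).

(* An observable on a compact space is bounded, so that both real integrals
   are those of integrable functions. *)
Definition cintegral mu (phi : X -> R[i]) : R[i] :=
  Complex (\int[mu]_x complex.Re (phi x)) (\int[mu]_x complex.Im (phi x)).

Definition birkhoff_avg T (phi : X -> R[i]) (n : nat) (x : X) : R[i] :=
  n%:R^-1 * \sum_(i < n) phi (iter i T x).

Definition deviation_set T mu (phi : X -> R[i]) (eps : R) (n : nat) : set X :=
  [set x | eps <
    ComplexField.Normc.normc (birkhoff_avg T phi n x - cintegral mu phi)].

Definition LDT_I' T mu : Prop :=
  forall (phi : X -> R[i]) (eps : R), observable phi -> 0 < eps ->
    (\sum_(1 <= n <oo) mu (deviation_set T mu phi eps n) < +oo)%E.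

Definition invariant_measure T mu : Prop :=
  forall B : set (borel X), measurable B -> mu (T @^-1` B) = mu B.

Definition ergodic T mu : Prop :=
  invariant_measure T mu /\
  forall B : set (borel X), measurable B -> T @^-1` B = B ->
    mu B = 0%E \/ mu B = 1%E.

End Dynamics.

(* Main.v *)
(* Summability forces the measures of the deviation sets of every continuous
   [f : X -> [0, 1]] to tend to 0, and this convergence in measure suffices: no
   almost everywhere statement is needed.
   - Invariance. The averages of [f] and [f \o T] at a point differ by at most
     [1 / n]; at a point outside both deviation sets they are close to the
     integrals of [f] and of [f \o T], which therefore agree.
   - Ergodicity. If [T @^-1` D = D], then [f] and its averages have the same
     integral over [D], and the averages are close to the constant [c], the
     integral of [f], off a set of small measure; so the integral of [f] over
     [D] is [mu D * c].
   An open set [U] is the increasing limit of such functions, so both identities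
   pass to open sets, hence to Borel sets. The second one becomes
   [mu (B `&` D) = mu D * mu B], and [B := D] gives [mu D = mu D ^ 2]. *)

Require Import Defs.
From HB Require Import structures.
From mathcomp Require Import all_boot all_order all_algebra.
From mathcomp Require Import complex.
From mathcomp Require Import all_classical all_reals all_analysis.
From mathcomp Require Import measurable_realfun.
From mathcomp Require Import lra.

Set Implicit Arguments.
Unset Strict Implicit.
Unset Printing Implicit Defensive.

Import Order.TTheory GRing.Theory Num.Theory.
Import numFieldNormedType.Exports.

Local Open Scope classical_set_scope.
Local Open Scope ring_scope.

(** Each term is squeezed between 0 and the tail that starts with it, and the tails of a convergent
    series vanish. *)
Lemma nneseries_cvg0 (R : realType) (u : (\bar R)^nat) :
  (forall n, 0 <= u n)%E -> (\sum_(0 <= n <oo) u n < +oo)%E ->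
  u n @[n --> \oo] --> 0%E.
Proof.
move=> u0 /nneseries_tail_cvg/(_ (fun k _ => u0 k)) tail0.
apply: (squeeze_cvge _ (cvg_cst _) tail0); apply: nearW => N; rewrite u0 /=.
have := @nneseries_lim_ge R u xpredT N N.+1 (fun k _ _ => u0 k).
by rewrite big_nat1.
Qed.

(** * Borel measures and continuous functions *)

Section Borel.
Variables (R : realType) (X : pointedMetricType R).

Lemma borel_open (U : set X) : open U -> measurable (U : set (borel X)).
Proof. exact: sub_sigma_algebra. Qed.

Lemma continuous_borel_measurable (f : X -> R) :
  continuous f -> measurable_fun [set: borel X] (f : borel X -> R).
Proof.
move=> /continuousP cf; apply: (measurability _ (RGenOpens.measurableE R)).
move=> _ [_ [a [b ->] <-]]; rewrite setTI.
by apply: borel_open; apply: cf; exact: interval_open.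
Qed.

Lemma continuous_borel_measurable_self (T : X -> X) :
  continuous T -> measurable_fun [set: borel X] (T : borel X -> borel X).
Proof.
move=> /continuousP cT.
apply: (@measurability _ _ (borel X) (borel X) setT T (@open X)) => //.
by move=> _ [U oU <-]; rewrite setTI; apply: borel_open; exact: cT.
Qed.

(** Open sets are stable under intersection and generate the Borel sets, and the whole space is open
    of finite measure, so uniqueness on a pi-system applies. *)
Lemma borel_measure_unique (m1 m2 : {measure set (borel X) -> \bar R}) :
  (forall U : set X, open U -> m1 U = m2 U) -> (m1 setT < +oo)%E ->
  forall B, measurable B -> m1 B = m2 B.
Proof.
move=> m12 m1oo B mB.
apply: (@measure_unique _ R (borel X) (@open X) (fun=> setT)) => //.
- exact: openI.
- by move=> _; exact: openT.
- by rewrite bigcup_const//; exists 0.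
Qed.

Lemma edist_inf_gt0 (A : set X) (x : X) :
  closed A -> ~ A x -> (0 < edist_inf A x)%E.
Proof.
move=> cA nAx.
have : nbhs x (~` A) by apply: open_nbhs_nbhs; split => //; exact: closed_openC.
rewrite -nbhs_ballE => -[e /= e0 xeA].
apply: (@lt_le_trans _ _ e%:E); first by rewrite lte_fin.
rewrite leNgt; apply/negP => /ereal_inf_lt[_ [a Aa <-]].
by move=> /(@edist_lt_ball R X _ (x, a)) /xeA.
Qed.

(** The witness is [min (k * d x) 1], with [d] the distance to the complement of [U]: it vanishes
    off [U], and at a point of [U], where [d x > 0], it equals 1 as soon as [k >= 1 / d x]. *)
Lemma open_continuous_approx (U : set X) : open U ->
  exists f : nat -> X -> R, [/\ forall k, continuous (f k),
    forall k x, 0 <= f k x <= 1,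
    forall x, nondecreasing_seq (f ^~ x) &
    forall x, f k x @[k --> \oo] --> (\1_U x : R)].
Proof.
(* The distance to an empty complement is [+oo], which [fine] would send to 0; this case takes the
   constant 1 instead. *)
move=> oU; have [U0|/set0P[a Ua]] := eqVneq (~` U) set0.
  exists (fun _ _ => 1); split => //.
  - by move=> k x; exact: cvg_cst.
  - by move=> k x; rewrite ler01 lexx.
  - by move=> x p q _; exact: lexx.
  - move=> x; rewrite indicE mem_set; first exact: cvg_cst.
    by rewrite -(setCK U) U0 setC0.
have dfin x : edist_inf (~` U) x \is a fin_num.
  rewrite ge0_fin_numE ?edist_inf_ge0//.
  apply: (@le_lt_trans _ _ (@edist R X (x, a))).
    by apply: ereal_inf_lbound; exists a.
  rewrite -ge0_fin_numE//; apply/edist_finP; exists (mdist x a + 1) => /=.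
    by rewrite ltr_wpDl// mdist_ge0.
  by rewrite ballEmdist /= ltrDl.
pose d x := fine (edist_inf (~` U) x).
have d0 x : 0 <= d x by rewrite fine_ge0// edist_inf_ge0.
have cd : continuous d.
  move=> x; apply: fine_cvg; rewrite fineK//.
  exact: edist_inf_continuous.
exists (fun k x => Num.min (k%:R * d x) 1); split.
- move=> k x; apply: (@continuous_min _ _ (fun x => k%:R * d x) (cst 1)).
    by apply: cvgM; [exact: cvg_cst|exact: cd].
  exact: cvg_cst.
- by move=> k x; rewrite le_min ler01 mulr_ge0//= ge_min lexx orbT.
- move=> x m n mn; rewrite le_min !ge_min lexx orbT andbT.
  by rewrite ler_wpM2r ?ler_nat.
- move=> x; rewrite indicE; have [/set_mem Ux|/negP xU] := boolP (x \in U).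
    have dx : 0 < d x.
      rewrite fine_gt0// ltey_eq dfin andbT edist_inf_gt0//.
      exact: open_closedC.
    apply: cvg_near_cst; near=> k; rewrite min_r// -ler_pdivrMr//.
    by near: k; exact: nbhs_infty_ger.
  apply: cvg_near_cst; near=> k; rewrite /d edist_inf0//.
    by rewrite mulr0 min_l.
  by move=> /= Ux; apply: xU; rewrite inE.
Unshelve. all: by end_near. Qed.

(** Monotone convergence over [D]. It serves with [D] the whole space for invariance and with [D] an
    invariant set for ergodicity. *)
Lemma measure_open_approx (m : {measure set (borel X) -> \bar R})
    (D : set (borel X)) (U : set X) (f : nat -> X -> R) :
  measurable D -> open U ->
  (forall k, continuous (f k)) -> (forall k x, 0 <= f k x <= 1) ->
  (forall x, nondecreasing_seq (f ^~ x)) ->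
  (forall x, f k x @[k --> \oo] --> (\1_U x : R)) ->
  (\int[m]_(x in D) (f k x)%:E @[k --> \oo] --> m (U `&` D))%E.
Proof.
move=> mD oU cf f01 ndf fU.
rewrite -integral_indic//; last exact: borel_open.
rewrite (_ : (\int[m]_(x in D) _)%E =
    (\int[m]_(x in D) limn (fun k => (f k x)%:E))%E).
  apply: cvg_monotone_convergence => //.
  - move=> k; apply/measurable_EFinP/measurable_funTS.
    exact: continuous_borel_measurable.
  - by move=> k x _; rewrite lee_fin; case/andP: (f01 k x).
  - by move=> x _ p q pq; rewrite lee_fin; exact: ndf.
apply: eq_integral => x _; apply/esym/cvg_lim => //.
by apply: cvg_EFin; [exact: nearW|exact: fU].
Qed.

End Borel.

(** * Birkhoff averages of real observables *)

Section Dynamics.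
Variables (R : realType) (X : pointedMetricType R) (T : X -> X).
Hypothesis cT : continuous T.
Variable mu : probability (borel X) R.

Definition real_avg (f : X -> R) (n : nat) (x : X) : R :=
  n%:R^-1 * \sum_(i < n) f (iter i T x).

Definition real_dev (f : X -> R) (eps : R) (n : nat) : set (borel X) :=
  [set x | eps < `|real_avg f n x - \int[mu]_y f y|].

Hypothesis cptX : compact [set: X].

Lemma compact_continuous_integrable (f : X -> R) (D : set (borel X)) :
  continuous f -> measurable D -> mu.-integrable D (EFin \o f).
Proof.
move=> cf mD; apply: measurable_bounded_integrable => //.
- by rewrite (le_lt_trans (probability_le1 _ _)) ?ltry.
- by apply: measurable_funTS; exact: continuous_borel_measurable.
- have [M [Mr fM]] : bounded_set (f @` [set: X]).
    apply/compact_bounded/continuous_compact => //.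
    exact: continuous_subspaceT.
  by exists M; split=> // N MN x _; apply: fM => //; exists x.
Qed.

Lemma continuous_iter i : continuous (iter i T).
Proof.
elim: i => [|i IH] x; first exact: cvg_id.
apply: (@continuous_comp _ _ _ (iter i T) T); [exact: IH|exact: cT].
Qed.

Lemma continuous_comp_iter (f : X -> R) i :
  continuous f -> continuous (fun x => f (iter i T x)).
Proof.
move=> cf x; apply: (@continuous_comp _ _ _ (iter i T) f).
  exact: continuous_iter.
exact: cf.
Qed.

Lemma continuous_real_avg (f : X -> R) n :
  continuous f -> continuous (real_avg f n).
Proof.
move=> cf x; apply: cvgM; first exact: cvg_cst.
apply: (@cvg_big _ _ _ _ _ _ _ _ _ (fun (i : 'I_n) x => f (iter i T x))).
  exact: add_continuous.
by move=> i _; exact: continuous_comp_iter.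
Qed.

Lemma measurable_real_dev (f : X -> R) eps n :
  continuous f -> measurable (real_dev f eps n).
Proof.
move=> cf; apply: borel_open.
have cg : continuous (fun x => `|real_avg f n x - \int[mu]_y f y|).
  move=> x; apply: cvg_norm; apply: cvgB; last exact: cvg_cst.
  exact: continuous_real_avg.
by move/continuousP : cg => /(_ _ (@open_gt _ eps)).
Qed.

Lemma observable_real (f : X -> R) :
  continuous f -> observable (fun x => (f x)%:C%C).
Proof.
(* The order of [R[i]] only compares numbers with equal imaginary parts, so a positive radius is
   real. *)
move=> cf x; apply/cvgrPdist_lt => -[e ei]; rewrite ltcE/= => /andP[/eqP -> e0].
have /cvgrPdist_lt/(_ _ e0) := cf x; apply: filterS => y.
by rewrite -raddfB normc_def/= expr0n addr0 sqrtr_sqr ltcR.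
Qed.

Lemma deviation_set_real (f : X -> R) eps n :
  deviation_set T mu (fun x => (f x)%:C%C) eps n = real_dev f eps n.
Proof.
rewrite /deviation_set /real_dev; apply/funext => x /=.
congr (is_true (_ < _)).
have -> : birkhoff_avg T (fun x => (f x)%:C%C) n x = (real_avg f n x)%:C%C.
  by rewrite /birkhoff_avg /real_avg rmorphM /= fmorphV rmorph_nat rmorph_sum.
rewrite /cintegral /= Rintegral_cst// mul0r.
by rewrite subr0 expr0n addr0 sqrtr_sqr.
Qed.

(** * From summability to convergence in measure *)

Hypothesis ldt : LDT_I' T mu.

Lemma real_dev_cvg0 (f : X -> R) (eps : R) : continuous f -> 0 < eps ->
  (mu (real_dev f eps n) @[n --> \oo] --> 0)%E.
Proof.
move=> cf eps0; apply: nneseries_cvg0 => //.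
have := ldt (observable_real cf) eps0.
under [X in (X < _)%E -> _]eq_eseriesr do rewrite deviation_set_real.
(* The hypothesis sums from 1; the extra term of index 0 is at most 1. *)
move=> sum1; rewrite nneseries_recl//; apply: lte_add_pinfty => //.
rewrite (le_lt_trans (probability_le1 _ _)) ?ltry//.
exact: measurable_real_dev.
Qed.

Lemma real_dev_small (f : X -> R) (eps d : R) :
  continuous f -> 0 < eps -> 0 < d ->
  \forall n \near \oo, (mu (real_dev f eps n) < d%:E)%E.
Proof.
move=> cf eps0 d0; have := real_dev_cvg0 cf eps0.
move=> /(_ [set y | (y < d%:E)%E]); apply.
apply: open_nbhs_nbhs; split; first exact: open_ereal_lt_ereal.
by rewrite /= lte_fin.
Qed.

(** * Invariance of the measure *)

Lemma real_avg_comp (f : X -> R) n x : (forall x, 0 <= f x <= 1) ->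
  `|real_avg (f \o T) n x - real_avg f n x| <= n%:R^-1.
Proof.
move=> f01; rewrite -mulrBr -sumrB normrM ger0_norm ?invr_ge0//.
rewrite -[leRHS]mulr1 ler_wpM2l ?invr_ge0//.
(* The sum telescopes to [f (iter n T x) - f x], a difference of two numbers in [0, 1]. *)
rewrite -(big_mkord xpredT (fun i => f (iter i.+1 T x) - f (iter i T x))).
rewrite (telescope_sumr (fun i => f (iter i T x)))// ler_norml.
by have := f01 (iter n T x); have := f01 x; lra.
Qed.

Lemma LDT_Rintegral_comp (f : X -> R) :
  continuous f -> (forall x, 0 <= f x <= 1) ->
  \int[mu]_x f (T x) = \int[mu]_x f x.
Proof.
move=> cf f01; apply/eqP; rewrite -subr_eq0 -normr_le0.
apply/ler_addgt0Pr => e e0; rewrite add0r.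
(* One third for each of the two deviations, one for the gap [1 / n] between the averages. *)
have e3 : 0 < e / 3 by rewrite divr_gt0.
have h2 : (0 < 2^-1 :> R) by rewrite invr_gt0.
have cfT : continuous (f \o T).
  by move=> x; apply: continuous_comp; [exact: cT|exact: cf].
near \oo => n.
(* For large [n] both deviation sets have measure below 1/2, so they cannot cover the space. *)
have [x [/= x1 x2]] : exists x,
    ~ real_dev (f \o T) (e / 3) n x /\ ~ real_dev f (e / 3) n x.
  apply: contrapT => /forallNP dev.
  have : (mu setT <=
      mu (real_dev (f \o T) (e / 3) n `|` real_dev f (e / 3) n))%E.
    apply: le_measure; rewrite ?inE//.
      by apply: measurableU; exact: measurable_real_dev.
    by move=> x _; apply: contrapT => /not_orP; exact: dev.
  apply/negP; rewrite -ltNge probability_setT.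
  apply: (le_lt_trans (measureU2 _ _ _)); try exact: measurable_real_dev.
  rewrite (_ : 1%E = (2^-1)%:E + (2^-1)%:E)%E; last first.
    by rewrite -EFinD; congr EFin; lra.
  by apply: lteD; near: n; exact: real_dev_small.
have := real_avg_comp n x f01.
have n3 : n%:R^-1 <= e / 3.
  rewrite invf_ple ?posrE//; last first.
    by rewrite ltr0n; near: n; exact: nbhs_infty_gt.
  by near: n; exact: nbhs_infty_ger.
move: x1 x2 => /negP; rewrite -leNgt => + /negP; rewrite -leNgt.
by rewrite !ler_norml /=; lra.
Unshelve. all: by end_near. Qed.

Let mT : measurable_fun [set: borel X] (T : borel X -> borel X) :=
  continuous_borel_measurable_self cT.

Lemma LDT_invariant : invariant_measure T mu.
Proof.
(* Packing [T] as a measurable function makes its pushforward of [mu] a measure, so that invariance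
   is an equality of two measures, to be checked on open sets. *)
pose mfT : {mfun borel X >-> borel X} :=
  HB.pack (T : borel X -> borel X) (isMeasurableFun.Build _ _ _ _ _ mT).
apply: (@borel_measure_unique _ _ (distribution mu mfT) mu); last first.
  by rewrite /= /distribution /pushforward preimage_setT probability_setT ltry.
move=> U oU; have [f [cf f01 ndf fU]] := open_continuous_approx oU.
have nuU :=
  measure_open_approx (m := distribution mu mfT) measurableT oU cf f01 ndf fU.
have muU := measure_open_approx (m := mu) measurableT oU cf f01 ndf fU.
rewrite !setIT in nuU muU.
apply: (cvg_unique _ nuU); first exact: ereal_hausdorff.
rewrite (_ : (fun k => _) = (fun k => \int[mu]_x (f k x)%:E)%E)//.
apply/funext => k; rewrite ge0_integral_distribution; last 2 first.
- by apply/measurable_EFinP; exact: continuous_borel_measurable.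
- by move=> x; rewrite lee_fin; case/andP: (f01 k x).
have cfT : continuous (f k \o T).
  by move=> x; apply: continuous_comp; [exact: cT|exact: cf].
rewrite -[LHS]fineK; last first.
  by apply: integrable_fin_num => //; exact: compact_continuous_integrable.
rewrite -[RHS]fineK; last first.
  by apply: integrable_fin_num => //; exact: compact_continuous_integrable.
by congr EFin; exact: LDT_Rintegral_comp.
Qed.

(** * Ergodicity: integrals over an invariant set *)

Section invariant_set.
Variable D : set (borel X).
Hypotheses (mD : measurable D) (TD : T @^-1` D = D).

Lemma Rintegral_iter (f : X -> R) i : continuous f ->
  \int[mu]_(x in D) f (iter i T x) = \int[mu]_(x in D) f x.
Proof.
move=> cf; elim: i => [//|i <-]; rewrite /Rintegral; congr fine.
have cfi := continuous_comp_iter (i := i) cf.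
have cfT : continuous ((fun x => f (iter i T x)) \o T).
  by move=> x; apply: continuous_comp; [exact: cT|exact: cfi].
rewrite -[in LHS]TD; under eq_integral do rewrite iterSr.
transitivity (\int[pushforward mu (T : borel X -> borel X)]_(x in D)
    (f (iter i T x))%:E)%E.
  rewrite integral_pushforward//.
  - by apply/measurable_EFinP; exact: continuous_borel_measurable.
  - by rewrite TD; exact: compact_continuous_integrable.
by apply: eq_measure_integral => A mA _; exact: LDT_invariant.
Qed.

(** The index is [n.+1] because the average of index 0 is the constant 0. *)
Lemma Rintegral_real_avg (f : X -> R) n : continuous f ->
  \int[mu]_(x in D) real_avg f n.+1 x = \int[mu]_(x in D) f x.
Proof.
move=> cf; have csum m : continuous (fun x => \sum_(i < m) f (iter i T x)).
  move=> x.
  apply: (@cvg_big _ _ _ _ _ _ _ _ _ (fun (i : 'I_m) x => f (iter i T x))).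
    exact: add_continuous.
  by move=> i _; exact: continuous_comp_iter.
rewrite RintegralZl//; last exact: compact_continuous_integrable.
suff -> m : \int[mu]_(x in D) (\sum_(i < m) f (iter i T x)) =
    m%:R * \int[mu]_(x in D) f x.
  by rewrite mulrA mulVf ?mul1r.
elim: m => [|m IH].
  under eq_Rintegral do rewrite big_ord0.
  by rewrite Rintegral_cst// !mul0r.
under eq_Rintegral do rewrite big_ord_recr /=.
rewrite RintegralD//; last 2 first.
- by apply: compact_continuous_integrable => //; exact: csum.
- by apply: compact_continuous_integrable => //; exact: continuous_comp_iter.
by rewrite IH Rintegral_iter// -natr1 mulrDl mul1r.
Qed.

Lemma real_avg_itv (f : X -> R) n x : (forall x, 0 <= f x <= 1) ->
  0 <= real_avg f n x <= 1.
Proof.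
move=> f01; apply/andP; split.
  rewrite mulr_ge0 ?invr_ge0// sumr_ge0// => i _.
  by case/andP: (f01 (iter i T x)).
case: n => [|n]; first by rewrite /real_avg invr0 mul0r ler01.
rewrite ler_pdivrMl// mulr1 -[leRHS]mulr1.
rewrite (le_trans (ler_sum _ (G := fun=> 1) _))//.
  by move=> i _; case/andP: (f01 (iter i T x)).
by rewrite sumr_const card_ord mulr1.
Qed.

Lemma Rintegral_itv (f : X -> R) : continuous f -> (forall x, 0 <= f x <= 1) ->
  0 <= \int[mu]_x f x <= 1.
Proof.
move=> cf f01; apply/andP; split.
  by apply: Rintegral_ge0 => x _; case/andP: (f01 x).
have -> : 1 = \int[mu]_(x in [set: borel X]) (1 : R).
  by rewrite Rintegral_cst// mul1r [X in fine X](@probability_setT _ _ _ mu).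
apply: le_Rintegral => //; first exact: compact_continuous_integrable.
- by apply: compact_continuous_integrable => // x; exact: cvg_cst.
- by move=> x _; case/andP: (f01 x).
Qed.

Lemma LDT_Rintegral_invariant_set (f : X -> R) :
  continuous f -> (forall x, 0 <= f x <= 1) ->
  \int[mu]_(x in D) f x = fine (mu D) * \int[mu]_x f x.
Proof.
move=> cf f01; set c := \int[mu]_x f x.
have c01 : 0 <= c <= 1 by exact: Rintegral_itv.
apply/eqP; rewrite -subr_eq0 -normr_le0.
apply/ler_addgt0Pr => e e0; rewrite add0r.
have e2 : 0 < e / 2 by rewrite divr_gt0.
near \oo => n.
have n0 : (0 < n)%N by near: n; exact: nbhs_infty_gt.
have mdev := measurable_real_dev (e / 2) n cf.
have dev_small : (mu (real_dev f (e / 2) n) < (e / 2)%:E)%E.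
  by near: n; exact: real_dev_small.
have icst (r : R) : mu.-integrable D (EFin \o cst r).
  by apply: compact_continuous_integrable => // x; exact: cvg_cst.
have iavg : mu.-integrable D (EFin \o real_avg f n).
  by apply: compact_continuous_integrable => //; exact: continuous_real_avg.
have ind : mu.-integrable D (EFin \o \1_(real_dev f (e / 2) n)).
  by apply: (@integrableS _ _ _ mu setT) => //; exact: integrable_indic.
(* The two sides become the integrals over [D] of the average and of the constant [c]. *)
rewrite -(Rintegral_real_avg n.-1 cf) prednK// mulrC -Rintegral_cst//.
rewrite -(RintegralB mD iavg (icst c)).
have idiff : mu.-integrable D (EFin \o (fun x => real_avg f n x - c)).
  exact: eq_integrable (integrableB mD iavg (icst c)).
apply: (le_trans (le_normr_Rintegral _ _)) => //.
(* Off the deviation set the average is within [e / 2] of [c]; on it the gap is at most 1, both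
   numbers being in [0, 1]. Integrating gives at most [e / 2 * mu D] plus the measure of the
   deviation set, hence at most [e]. *)
apply: (@le_trans _ _
    (\int[mu]_(x in D) (e / 2 + \1_(real_dev f (e / 2) n) x))).
  apply: le_Rintegral => //.
  - exact: integrable_norm.
  - exact: eq_integrable (integrableD mD (icst (e / 2)) ind).
  - move=> x _; rewrite indicE.
    have [xdev|/negP xdev] := boolP (x \in real_dev f (e / 2) n).
      have := real_avg_itv n x f01; by rewrite mulr1n ler_norml /cst; lra.
    by rewrite addr0 leNgt; apply/negP => xd; apply: xdev; exact: mem_set.
rewrite (RintegralD mD (icst (e / 2)) ind) Rintegral_cst//.
have -> : \int[mu]_(x in D) \1_(real_dev f (e / 2) n) x =
    fine (mu (real_dev f (e / 2) n `&` D)).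
  by rewrite /Rintegral integral_indic.
have : fine (mu (real_dev f (e / 2) n `&` D)) <= e / 2.
  rewrite -lee_fin fineK ?fin_num_measure//; last exact: measurableI.
  apply: (le_trans _ (ltW dev_small)); apply: le_measure; rewrite ?inE//.
  exact: measurableI.
have : fine (mu D) <= 1.
  by rewrite -lee_fin fineK ?fin_num_measure// probability_le1.
nra.
Unshelve. all: by end_near. Qed.

Lemma LDT_zero_one : mu D = 0%E \/ mu D = 1%E.
Proof.
have muD : mu D = (fine (mu D))%:E by rewrite fineK// fin_num_measure.
have r0 : 0 <= fine (mu D) by rewrite fine_ge0.
(* The restriction of [mu] to [D] and the multiple of [mu] by [mu D] are compared as measures; their
   values at [D] give [r * (r - 1) = 0] for [r = fine (mu D)]. *)
suff : mrestr mu mD D = mscale (NngNum r0) mu D.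
  rewrite /mrestr setIid /mscale /= muD -EFinM => -[] /esym/eqP.
  rewrite -subr_eq0 -[X in _ - X]mulr1 -mulrBr mulf_eq0 subr_eq0.
  by move=> /orP[] /eqP ->; [left|right].
apply: borel_measure_unique => //; last first.
  by rewrite /= /mrestr setTI (le_lt_trans (probability_le1 _ _)) ?ltry.
move=> U oU; have [f [cf f01 ndf fU]] := open_continuous_approx oU.
have muUD := measure_open_approx (m := mu) mD oU cf f01 ndf fU.
have muU := measure_open_approx (m := mu) measurableT oU cf f01 ndf fU.
rewrite setIT in muU.
apply: (cvg_unique _ muUD); first exact: ereal_hausdorff.
rewrite (_ : (fun k => _) =
    (fun k => (fine (mu D))%:E * \int[mu]_x (f k x)%:E)%E).
  by apply: cvgeZl.
apply/funext => k.
rewrite -[LHS]fineK; last first.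
  by apply: integrable_fin_num => //; exact: compact_continuous_integrable.
rewrite -[(\int[mu]_x _)%E]fineK; last first.
  by apply: integrable_fin_num => //; exact: compact_continuous_integrable.
by rewrite -EFinM; congr EFin; exact: LDT_Rintegral_invariant_set.
Qed.

End invariant_set.
End Dynamics.

Theorem theorem3p1 (R : realType) (X : pointedMetricType R)
  (cptX : compact [set: X]) (T : X -> X) (cT : continuous T)
  (mu : probability (borel X) R) :
  LDT_I' T mu -> ergodic T mu.
Proof.
move=> ldt; split; first exact: LDT_invariant.
by move=> B mB TB; exact: LDT_zero_one TB.
Qed.
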